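(* Let $\lambda\in\mathbb{R}^d$ have positive entries and let $X=(X_t)_{t\in\mathbb{R}}$ be a continuous $\mathbb{R}^d$-valued (increment) semimartingale such that its EFM-signature $\mathbb{X}^{\lambda}$ is well-defined. Then, for all $s\in\mathbb{R}\cup\{-\infty\}$ and $u,t\in\mathbb{R}$ with $s\le u\le t$, $$\mathbb{X}^{\lambda}_{s,t}=\big(\mathbf{D}^{\lambda}_{t-u}\,\mathbb{X}^{\lambda}_{s,u}\big)\otimes\mathbb{X}^{\lambda}_{u,t}.$$
   Context: $T((\mathbb{R}^d))$ is the space of sequences $\ell=(\ell^n)_{n\ge0}$ with $\ell^n\in(\mathbb{R}^d)^{\otimes n}$; its elements are written $\ell=\sum_{v}\ell^v v$, the sum being over words $v=i_1\cdots i_n$ in letters $\{1,\dots,d\}$ identified with $e_{i_1}\otimes\cdots\otimes e_{i_n}$ (the empty word $\varnothing$ spans $(\mathbb{R}^d)^{\otimes0}=\mathbb{R}$). The tensor product is $(p\otimes q)^v=\sum_{uw=v}p^uq^w$. For a word $v=i_1\cdots i_n$ put $\lambda^v=\sum_{k}\lambda^{i_k}$, $\lambda^\varnothing=0$. The operator $\mathbf{D}^{\lambda}_h$ is $\mathbf{D}^{\lambda}_h\ell=\sum_v e^{-\lambda^vh}\ell^vv$. An increment semimartingale is a process $X=(X_t)_{t\in\mathbb{R}}$ such that for each $s\in\mathbb{R}$, $(X_{s+t}-X_s)_{t\ge0}$ is a semimartingale with respect to $(\mathcal{F}_{s+t})_{t\ge0}$. $\circ\,dX$ denotes Stratonovich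 integration. The EFM-signature $\mathbb{X}^\lambda_{s,t}\in T((\mathbb{R}^d))$ has components $\mathbb{X}^{\lambda,\varnothing}_{s,t}=1$ and $$\mathbb{X}^{\lambda,i_1\cdots i_n}_{s,t}=\int_s^te^{-\lambda^{i_1\cdots i_n}(t-u)}\,\mathbb{X}^{\lambda,i_1\cdots i_{n-1}}_{s,u}\circ dX^{i_n}_u ,$$ where for $s=-\infty$ the integrals are improper stochastic integrals (limits as the lower endpoint tends to $-\infty$). A sufficient condition for well-definedness (the paper's standing assumption) is that $X=A+M$, with $A$ of bounded variation and $M$ an increment local martingale, where for all $T\in\mathbb{R}$ and $i$, $\int_{-\infty}^Te^{-\lambda^i(T-u)}d|A^i|_u+\int_{-\infty}^Te^{-2\lambda^i(T-u)}d\langle M^i\rangle_u<\infty$ almost surely. Identities between random variables hold almost surely. *)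

(* Defs.v *)
From HB Require Import structures.
From mathcomp Require Import all_boot all_order all_algebra.
From mathcomp Require Import all_classical all_reals all_analysis.
Import Order.TTheory GRing.Theory Num.Theory.
Import numFieldNormedType.Exports.

Set Implicit Arguments.
Unset Strict Implicit.
Unset Printing Implicit Defensive.

Local Open Scope classical_set_scope.
Local Open Scope ring_scope.

Section Tensor.
Context {R : realType} {d : nat}.

(* [l v] is the coefficient l^v of the word v in l = sum_v l^v v; the degree-n
   component of l is the restriction of l to the words of size n. *)
Definition tensor_series : Type := seq 'I_d -> R.

(* The pairs (u, w) with uw = v are the (take k v, drop k v), 0 <= k <= |v|. *)
Definition tensor_mul (p q : tensor_series) : tensor_series := fun v =>
  \sum_(k < (size v).+1) p (take k v) * q (drop k v).

Definition word_weight (lambda : 'rV[R]_d) (v : seq 'I_d) : R :=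
  \sum_(i <- v) lambda 0 i.

Definition discount (lambda : 'rV[R]_d) (h : R) (l : tensor_series) :
  tensor_series := fun v => expR (- (word_weight lambda v * h)) * l v.

End Tensor.
Arguments tensor_series : clear implicits.

Section Stochastic.
Context {disp : measure_display} {T : measurableType disp} {R : realType}.
Variable P : probability T R.
Implicit Types (F : R -> set_system T) (X Y M A : R -> T -> R).

Definition filtration F : Prop :=
  [/\ forall t, sigma_algebra setT (F t),
      forall t, F t `<=` measurable
    & forall s t, s <= t -> F s `<=` F t].

Definition measurable_wrt (G : set_system T) (Z : T -> R) : Prop :=
  preimage_set_system setT Z measurable `<=` G.

(* In the next definitions the time index is t >= 0; values of the filtration
   and of the processes at negative times are irrelevant. *)

Definition adapted F Y : Prop := forall t, 0 <= t -> measurable_wrt (F t) (Y t).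

Definition continuous_paths Y : Prop :=
  {ae P, forall w, {within `[0, +oo[, continuous (fun t => Y t w)}}.

(* E[M_t | F_s] = M_s, spelled out through integrals over the events of F_s. *)
Definition martingale F M : Prop :=
  [/\ adapted F M,
      forall t, 0 <= t -> P.-integrable setT (EFin \o M t)
    & forall s t, 0 <= s -> s <= t -> forall B, F s B ->
        (\int[P]_(w in B) (M t w)%:E = \int[P]_(w in B) (M s w)%:E)%E].

Definition stopping_time F (tau : T -> \bar R) : Prop :=
  (forall w, 0 <= tau w)%E /\
  forall t, 0 <= t -> F t [set w | tau w <= t%:E]%E.

Definition stopped (tau : T -> \bar R) Y : R -> T -> R :=
  fun t w => Y (fine (Order.min t%:E (tau w))) w.

Definition local_martingale F M : Prop :=
  adapted F M /\
  exists tau : nat -> T -> \bar R,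
    [/\ forall n, stopping_time F (tau n),
        {ae P, forall w, nondecreasing_seq (fun n => tau n w)},
        {ae P, forall w, tau n w @[n --> \oo] --> +oo%E}
      & forall n,
          martingale F (stopped (tau n) (fun t w => M t w - M 0 w))].

Definition finite_variation F A : Prop :=
  adapted F A /\
  {ae P, forall w, forall t, 0 <= t -> bounded_variation 0 t (fun r => A r w)}.

Definition continuous_semimartingale F Y : Prop :=
  adapted F Y /\
  exists M A,
    [/\ local_martingale F M, continuous_paths M,
        finite_variation F A, continuous_paths A
      & {ae P, forall w, forall t, 0 <= t -> Y t w = M t w + A t w}].

Definition continuous_semimartingale_from F (s : R) Y : Prop :=
  continuous_semimartingale (fun t => F (s + t)) (fun t => Y (s + t)).

(* X itself, as opposed to its increments, need not be adapted. *)
Definition continuous_increment_semimartingale F X : Prop :=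
  forall s, continuous_semimartingale_from F s (fun t w => X t w - X s w).

Definition cvg_in_probability {I : Type} (G : set_system I)
    (Z : I -> T -> R) (Zlim : T -> R) : Prop :=
  forall eps : R, 0 < eps ->
    P [set w | eps <= `|Z i w - Zlim w|] @[i --> G] --> 0%E.

(* Points t_0 = s < t_1 < ... < t_n = t of [p], where [itv_partition s t p]. *)
Definition grid_point (s t : R) (p : seq R) (k : nat) : R := nth t (s :: p) k.

Definition mesh (s t : R) (p : seq R) : R :=
  \big[Order.max/0]_(k < size p)
    (grid_point s t p k.+1 - grid_point s t p k).

(* The simple predictable process sum_k Z_k 1_{]t_k, t_{k+1}]}, with Z_k an
   F_{t_k}-measurable random variable. *)
Record simple_process F (s t : R) := SimpleProcess {
  sp_grid : seq R ;
  sp_coef : nat -> T -> R ;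
  sp_gridP : itv_partition s t sp_grid ;
  sp_coefP : forall k, (k < size sp_grid)%N ->
    measurable_wrt (F (grid_point s t sp_grid k)) (sp_coef k) }.

Definition sp_val F s t (H : simple_process F s t) (r : R) (w : T) : R :=
  \sum_(k < size (sp_grid H))
    sp_coef H k w * (grid_point s t (sp_grid H) k < r
                     <= grid_point s t (sp_grid H) k.+1)%R%:R.

Definition sp_integral F s t (H : simple_process F s t) X (w : T) : R :=
  \sum_(k < size (sp_grid H))
    sp_coef H k w * (X (grid_point s t (sp_grid H) k.+1) w
                     - X (grid_point s t (sp_grid H) k) w).

(* Convergence in probability of sup_{s < r <= t} |H^n_r - Y_r| to 0. The outer
   measure [P^*] avoids any discussion of the measurability of the event. *)
Definition ucp_cvg F s t (H : nat -> simple_process F s t) Y : Prop :=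
  forall eps : R, 0 < eps ->
    mu_ext P [set w | exists r, [/\ s < r, r <= t
                                  & eps <= `|sp_val (H n) r w - Y r w|]]
      @[n --> \oo] --> 0%E.

(* I = int_s^t Y dX: the integral is the extension by continuity (ucp to
   probability) of the elementary integral of simple predictable processes.
   It is used below only for continuous adapted integrands Y, which are ucp
   limits of simple processes, so that I is determined almost surely. *)
Definition ito_integral F Y X (s t : R) (I : T -> R) : Prop :=
  measurable_fun setT I /\
  forall H : nat -> simple_process F s t, ucp_cvg H Y ->
    cvg_in_probability \oo (fun n => sp_integral (H n) X) I.

(* Q = [Y, X]_t - [Y, X]_s *)
Definition quadratic_covariation Y X (s t : R) (Q : T -> R) : Prop :=
  measurable_fun setT Q /\
  forall p : nat -> seq R,
    (forall n, itv_partition s t (p n)) ->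
    mesh s t (p n) @[n --> \oo] --> 0 ->
    cvg_in_probability \oo (fun n w =>
      \sum_(k < size (p n))
        (Y (grid_point s t (p n) k.+1) w - Y (grid_point s t (p n) k) w) *
        (X (grid_point s t (p n) k.+1) w - X (grid_point s t (p n) k) w)) Q.

(* I = int_s^t Y o dX = int_s^t Y dX + ([Y, X]_t - [Y, X]_s) / 2 *)
Definition stratonovich_integral F Y X (s t : R) (I : T -> R) : Prop :=
  [/\ continuous_semimartingale_from F s Y,
      continuous_semimartingale_from F s (fun r w => X r w - X s w),
      measurable_fun setT I
    & exists J Q : T -> R,
        [/\ ito_integral F Y X s t J,
            quadratic_covariation Y X s t Q
          & {ae P, forall w, I w = J w + 2^-1 * Q w}]].

(* I = int_{-oo}^t Y o dX, the limit in probability of int_r^t Y o dX as r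
   tends to -oo. *)
Definition improper_stratonovich_integral F Y X (t : R) (I : T -> R) : Prop :=
  measurable_fun setT I /\
  exists J : R -> T -> R,
    (forall r, r <= t -> stratonovich_integral F Y X r t (J r)) /\
    cvg_in_probability (-oo%R) J I.

(* [XX s t w] is the value of the signature over [s, t] at the outcome w, where
   s is a real number or -oo. All the integrals are required to exist, so that
   [exists XX, is_efm_signature F lambda X XX] states that the EFM-signature of
   X is well-defined. *)
Definition is_efm_signature d F (lambda : 'rV[R]_d) (X : R -> T -> 'rV[R]_d)
    (XX : \bar R -> R -> T -> tensor_series R d) : Prop :=
  [/\ forall (s : \bar R) (t : R), (s <= t%:E)%E ->
        {ae P, forall w, XX s t w [::] = 1},
      forall (s t : R) (v : seq 'I_d) (i : 'I_d), s <= t ->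
        stratonovich_integral F
          (fun r w => expR (- (word_weight lambda (rcons v i) * (t - r)))
                      * XX s%:E r w v)
          (fun r w => X r w 0 i) s t (fun w => XX s%:E t w (rcons v i))
    & forall (t : R) (v : seq 'I_d) (i : 'I_d),
        improper_stratonovich_integral F
          (fun r w => expR (- (word_weight lambda (rcons v i) * (t - r)))
                      * XX -oo%E r w v)
          (fun r w => X r w 0 i) t (fun w => XX -oo%E t w (rcons v i))].

End Stochastic.

(* Main.v *)
Require Import Defs.
From HB Require Import structures.
From mathcomp Require Import all_boot all_order all_algebra.
From mathcomp Require Import all_classical all_reals all_analysis.
From mathcomp Require Import measurable_realfun ring lra.
Import Order.TTheory GRing.Theory Num.Theory.
Import numFieldNormedType.Exports.

(** The identity is that of Chen for iterated integrals, with discount factors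
    that are multiplicative along words.  It is proved by induction on the last
    letter of the word: the integral over [[s, t]] that defines a component
    splits at [u]; the part over [[s, u]] is the same component of the signature
    over [[s, u]], discounted by a constant, and in the part over [[u, t]] the
    induction hypothesis expands the integrand into a sum of products of a
    random variable known at time [u] and an integrand of the signature started
    at [u].

    What this takes of stochastic integration is additivity over intervals,
    linearity, and the right to move such a random variable out of an integral.
    All three follow at once from one fact, [stratonovich_trapezoid]: the
    Stratonovich integral of [Y] against [X] is the limit in probability of the
    sums of [(Y_{t_k} + Y_{t_{k+1}}) / 2 * (X_{t_{k+1}} - X_{t_k})] along any
    sequence of partitions whose mesh tends to 0.  At the level of these finite
    sums the three properties are elementary algebra, and they pass to the limit
    because limits in probability are almost surely unique and compatible with
    sums and with products by a fixed random variable ([stratonovich_split]).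

    For the trapezoidal sums to converge, the integrand sampled at the points of
    the partitions must converge to it uniformly in probability.  Its paths are
    almost surely uniformly continuous on compact intervals, and the required
    uniformity over outcomes comes from continuity of the probability along
    decreasing measurable events defined by rational times
    ([oscillation_negligible], [sampled_ucp]).

    When [s] is -oo, the splitting at [u] holds for all lower endpoints below [u]
    of the improper integrals, and is carried to the limit. *)

Set Implicit Arguments.
Unset Strict Implicit.
Unset Printing Implicit Defensive.

Local Open Scope classical_set_scope.
Local Open Scope ring_scope.

(** * Partitions and sums over their steps *)

Section Steps.
Context {R : realType}.
Implicit Types (a b c s t r x : R) (p q : seq R).

(** Listing the steps turns sums over the indices of a grid into sums over a
    list, which split when partitions are concatenated. *)
Definition steps s p : seq (R * R) := zip (s :: p) p.

Lemma big_grid (U : Type) (idx : U) (op : U -> U -> U) (f : R -> R -> U)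
    s t p :
  \big[op/idx]_(k < size p) f (grid_point s t p k) (grid_point s t p k.+1) =
  \big[op/idx]_(e <- steps s p) f e.1 e.2.
Proof.
elim: p s => [|x p ih] s; first by rewrite big_ord0 big_nil.
by rewrite /steps /= big_ord_recl big_cons -/(steps x p) -ih.
Qed.

Lemma steps_cat s p q : steps s (p ++ q) = steps s p ++ steps (last s p) q.
Proof. by elim: p s => [//|x p ih] s; rewrite /steps /= -!/(steps _ _) ih. Qed.

Lemma itv_partition_last a b p : itv_partition a b p -> last a p = b.
Proof. by case=> _ /eqP. Qed.

Lemma mem_steps1 s p e : e \in steps s p -> e.1 \in s :: p.
Proof.
elim: p s => [//|x p ih] s; rewrite in_cons => /predU1P[->|/ih].
  by rewrite mem_head.
by rewrite [e.1 \in s :: _]in_cons orbC => ->.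
Qed.

Lemma mem_steps2 s p e : e \in steps s p -> e.2 \in p.
Proof.
elim: p s => [//|x p ih] s; rewrite !in_cons => /predU1P[->|/ih ->].
  by rewrite eqxx.
by rewrite orbT.
Qed.

Lemma steps_bounds a b p e : itv_partition a b p -> e \in steps a p ->
  [/\ a <= e.1, e.1 <= b, a <= e.2 & e.2 <= b].
Proof.
elim: p a => [//|x p ih] a abp.
have ax : a < x by case: abp => /= /andP[].
have xbp := itv_partition_cons abp; have xb := itv_partition_le xbp.
rewrite /steps /= in_cons => /orP[/eqP -> /=|/ih-/(_ xbp)[? ? ? ?]].
  by rewrite lexx (ltW ax) xb (le_trans (ltW ax) xb).
by split=> //; exact: le_trans (ltW ax) _.
Qed.

Lemma mesh_ge0 a b p : 0 <= mesh a b p.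
Proof. exact: bigmax_ge_id. Qed.

Lemma step_le_mesh a b p e : e \in steps a p -> e.2 - e.1 <= mesh a b p.
Proof.
move=> ep; rewrite /mesh (big_grid 0 Order.max (fun x y => y - x)).
exact: (le_bigmax_seq 0 e xpredT (fun e => e.2 - e.1)).
Qed.

Lemma mesh_le a b p c : 0 <= c ->
  (forall e, e \in steps a p -> e.2 - e.1 <= c) -> mesh a b p <= c.
Proof.
move=> c0 pc; rewrite /mesh (big_grid 0 Order.max (fun x y => y - x)) big_seq.
exact: bigmax_le.
Qed.

Lemma mesh_cat a b c p q : itv_partition a b p ->
  mesh a c (p ++ q) <= mesh a b p + mesh b c q.
Proof.
move=> abp; apply: mesh_le => [|e]; first by rewrite addr_ge0 ?mesh_ge0.
rewrite steps_cat (itv_partition_last abp) mem_cat => /orP[ep|eq].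
  by rewrite (le_trans (step_le_mesh b ep))// lerDl mesh_ge0.
by rewrite (le_trans (step_le_mesh c eq))// lerDr mesh_ge0.
Qed.

Lemma exists_partitions a b : a <= b ->
  exists p : nat -> seq R, (forall n, itv_partition a b (p n)) /\
    mesh a b (p n) @[n --> \oo] --> 0.
Proof.
rewrite le_eqVlt => /predU1P[<-|ab].
  (* the only partition of a trivial interval is the empty one *)
  exists (fun=> [::]); split => //.
  rewrite (_ : (fun=> _) = cst 0); first exact: cvg_cst.
  by apply/funext => n; rewrite /mesh big_ord0.
pose x n k : R := a + (b - a) * (k%:R / n.+1%:R).
pose p n := [seq x n k | k <- iota 1 n.+1].
have x0 n : x n 0%N = a by rewrite /x mul0r mulr0 addr0.
have apE n : a :: p n = [seq x n k | k <- iota 0 n.+2].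
  by rewrite -[in LHS](x0 n).
have nth_p n i : (i < n.+1)%N -> nth 0 (p n) i = x n i.+1.
  by move=> ilt; rewrite (nth_map 0%N) ?size_iota// nth_iota// add1n.
have nth_ap n i : (i < n.+2)%N -> nth 0 (a :: p n) i = x n i.
  by move=> ilt; rewrite apE (nth_map 0%N) ?size_iota// nth_iota// add0n.
have szp n : size (p n) = n.+1 by rewrite size_map size_iota.
have szs n : size (zip (a :: p n) (p n)) = n.+1.
  rewrite size_zip -[size (a :: p n)]/((size (p n)).+1) szp.
  exact/minn_idPr.
have stepE n i : x n i.+1 - x n i = (b - a) / n.+1%:R.
  by rewrite /x opprD addrACA subrr add0r -mulrBr -mulrBl -natrB// subSnn mul1r.
have ba : 0 < b - a by rewrite subr_gt0.
exists p; split => [n|].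
  split.
    apply/(pathP 0) => i; rewrite szp => ilt.
    rewrite nth_p// nth_ap ?(ltn_trans ilt)// -subr_gt0 stepE.
    by rewrite divr_gt0 ?ltr0n.
  rewrite (last_nth 0) szp nth_ap// /x divff ?pnatr_eq0// mulr1.
  by rewrite addrCA subrr addr0.
apply: (@squeeze_cvgr _ _ _ _ (cst 0) (fun n => (b - a) * n.+1%:R^-1)).
- near=> n; rewrite mesh_ge0/=; apply: mesh_le => [|e].
    by rewrite divr_ge0 ?ltW.
  move=> /(nthP (0, 0))[i]; rewrite szs => ilt.
  rewrite nth_zip_cond szs ilt => <-/=.
  by rewrite nth_p// -[leRHS](stepE n i) nth_ap// (ltn_trans ilt).
- exact: cvg_cst.
- rewrite -[X in _ --> X](mulr0 (b - a)).
  by apply: cvgM; [exact: cvg_cst|exact: cvg_harmonic].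
Unshelve. all: by end_near. Qed.

(** A simple process is a function of time that is constant on each step, so
    its value at [r] is the one it takes on the unique step containing [r]. *)
Lemma step_value a b p r (f : R -> R) : itv_partition a b p -> a < r <= b ->
  exists2 e, e \in steps a p & e.1 < r <= e.2 /\
    \sum_(e <- steps a p) f e.1 * (e.1 < r <= e.2)%R%:R = f e.1.
Proof.
elim: p a => [|x p ih] a abp.
  by rewrite (itv_partition_nil abp) ltNge andNb.
have xbp := itv_partition_cons abp => /andP[ar rb].
rewrite /steps /= -/(steps x p); have [rx|xr] := leP r x.
  exists (a, x) => /=; first by rewrite in_cons eqxx.
  rewrite ar rx; split=> //; rewrite big_cons /= ar rx mulr1.
  rewrite big1_seq ?addr0// => e /= /(steps_bounds xbp)[xe _ _ _].
  by rewrite ltNge (le_trans rx xe) mulr0.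
have [|e ep [er fe]] := ih x xbp; first by rewrite xr rb.
exists e; first by rewrite in_cons ep orbT.
by split=> //; rewrite big_cons/= fe [r <= x]leNgt xr andbF mulr0 add0r.
Qed.

End Steps.

(** * Convergence in probability *)

Section InProbability.
Context {disp : measure_display} {T : measurableType disp} {R : realType}.
Variable P : probability T R.
Implicit Types (Z W : nat -> T -> R) (A B : set T) (C Zl Wl : T -> R).

Lemma ae_forall_countable (I : countType) (Q : I -> T -> Prop) :
  (forall i, {ae P, forall w, Q i w}) -> {ae P, forall w, forall i, Q i w}.
Proof.
move=> Qae.
have : {ae P, forall w, forall n : nat, forall i, unpickle n = Some i -> Q i w}.
  apply: ae_foralln => n; case: (unpickle n) => [i|]; last exact: aeW.
  by apply: filterS (Qae i) => w Qw j [<-].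
by apply: filterS => w Qw i; apply: (Qw (pickle i)); rewrite pickleK.
Qed.

Lemma le_measure_ae A B : measurable A -> measurable B ->
  {ae P, forall w, A w -> B w} -> (P A <= P B)%E.
Proof.
move=> mA mB [N [mN PN0 AN]].
rewrite -(measureU0 mB mN PN0); apply: le_measure; rewrite ?inE//.
  exact: measurableU.
move=> w Aw; have [Bw|nBw] := pselect (B w); first by left.
by right; apply: AN => /= /(_ Aw).
Qed.

Lemma cvg0_measure_le (a b : nat -> \bar R) : (forall n, 0 <= a n)%E ->
  (forall n, a n <= b n)%E -> b @ \oo --> 0%E -> a @ \oo --> 0%E.
Proof.
move=> a0 ab b0; apply: (@squeeze_cvge _ _ _ _ (cst 0%E) _ b) => //.
  by apply: nearW => n; rewrite a0 ab.
exact: cvg_cst.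
Qed.

Lemma cvg0_measure_eps (a : nat -> \bar R) : (forall n, 0 <= a n)%E ->
  (forall eps : R, 0 < eps -> \forall n \near \oo, (a n <= eps%:E)%E) ->
  a @ \oo --> 0%E.
Proof.
move=> a0 aeps; apply/fine_cvgP; split.
  apply: filterS (aeps _ ltr01) => n an1; rewrite ge0_fin_numE//.
  by rewrite (le_lt_trans an1) ?ltry.
apply/cvgr0Pnorm_lt => eps eps0.
have e2 : 0 < eps / 2 by rewrite divr_gt0.
apply: filterS (aeps _ e2) => n an /=.
have afin : a n \is a fin_num by rewrite ge0_fin_numE// (le_lt_trans an) ?ltry.
rewrite ger0_norm ?fine_ge0// (@le_lt_trans _ _ (eps / 2))//.
  by rewrite -lee_fin fineK.
by rewrite ltr_pdivrMr// ltr_pMr// ltr1n.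
Qed.

Lemma near_measure_le (a : nat -> \bar R) (eps : R) : (forall n, 0 <= a n)%E ->
  0 < eps -> a @ \oo --> 0%E -> \forall n \near \oo, (a n <= eps%:E)%E.
Proof.
move=> a0 eps0 /fine_cvgP[afin /cvgr0Pnorm_lt/(_ _ eps0) alt].
apply: filterS2 afin alt => n afin /= alt; rewrite -(fineK afin) lee_fin.
by rewrite ltW// (le_lt_trans (ler_norm _)).
Qed.

Lemma measurable_norm_ge C (eps : R) : measurable_fun setT C ->
  measurable [set w | eps <= `|C w|].
Proof.
move=> mC.
rewrite (_ : [set w | _] = setT `&` (Num.norm \o C) @^-1` `[eps, +oo[).
  by apply: (measurableT_comp _ mC) => //; exact: normr_measurable.
by apply/seteqP; split=> w /=; rewrite in_itv/= andbT => // -[].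
Qed.

Lemma measurable_dist_ge C Zl (eps : R) :
  measurable_fun setT C -> measurable_fun setT Zl ->
  measurable [set w | eps <= `|C w - Zl w|].
Proof. by move=> mC mZl; apply: measurable_norm_ge; exact: measurable_funB. Qed.

Lemma cvg_in_probability_ae Z Zl W Wl :
  (forall n, measurable_fun setT (Z n)) -> measurable_fun setT Zl ->
  (forall n, measurable_fun setT (W n)) -> measurable_fun setT Wl ->
  (forall n, {ae P, forall w, Z n w = W n w}) ->
  {ae P, forall w, Zl w = Wl w} ->
  cvg_in_probability P \oo Z Zl -> cvg_in_probability P \oo W Wl.
Proof.
move=> mZ mZl mW mWl ZW ZWl cZ eps eps0.
apply: cvg0_measure_le (cZ eps eps0) => // n.
apply: le_measure_ae; do ?exact: measurable_dist_ge.
by apply: filterS2 (ZW n) ZWl => w /= -> ->.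
Qed.

Lemma cvg_in_probabilityD Z Zl W Wl :
  (forall n, measurable_fun setT (Z n)) -> measurable_fun setT Zl ->
  (forall n, measurable_fun setT (W n)) -> measurable_fun setT Wl ->
  cvg_in_probability P \oo Z Zl -> cvg_in_probability P \oo W Wl ->
  cvg_in_probability P \oo (fun n w => Z n w + W n w) (fun w => Zl w + Wl w).
Proof.
move=> mZ mZl mW mWl cZ cW eps eps0.
have e2 : 0 < eps / 2 by rewrite divr_gt0.
have := cvgeD _ (cZ _ e2) (cW _ e2); rewrite adde0 => /(_ _ isT).
apply: cvg0_measure_le => // n /=.
have mA := measurable_dist_ge (eps / 2) (mZ n) mZl.
have mB := measurable_dist_ge (eps / 2) (mW n) mWl.
apply: le_trans (measureU2 _ mA mB); apply: le_measure; rewrite ?inE.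
- by apply: measurable_dist_ge; exact: measurable_funD.
- exact: measurableU.
move=> w /= le_eps.
have [?|Zlt] := leP (eps / 2) `|Z n w - Zl w|; [by left|right].
rewrite leNgt; apply/negP => Wlt.
move: le_eps; rewrite leNgt => /negP; apply.
rewrite opprD addrACA (le_lt_trans (ler_normD _ _))//.
by rewrite [ltRHS](splitr eps) ltrD.
Qed.

(** A finite random variable is bounded outside an event of small probability,
    so convergence in probability survives multiplication by it; this is what
    lets a factor known at time [u] leave an integral that starts at [u]. *)
Lemma cvg_in_probabilityMl C Z Zl : measurable_fun setT C ->
  (forall n, measurable_fun setT (Z n)) -> measurable_fun setT Zl ->
  cvg_in_probability P \oo Z Zl ->
  cvg_in_probability P \oo (fun n w => C w * Z n w) (fun w => C w * Zl w).
Proof.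
move=> mC mZ mZl cZ eps eps0.
pose A k := [set w | k.+1%:R <= `|C w|].
have mA k : measurable (A k) by exact: measurable_norm_ge.
have PA : (P \o A) @ \oo --> 0%E.
  have A0 : \bigcap_k A k = set0.
    rewrite -subset0 => w Aw.
    have := Aw (Num.trunc `|C w|) I; rewrite /A /= leNgt => /negP; apply.
    exact: truncnS_gt.
  rewrite -(measure0 P) -A0; apply: nonincreasing_cvg_mu => //.
  - by rewrite (le_lt_trans (probability_le1 _ _)) ?ltry.
  - by rewrite A0.
  - move=> m n mn; apply/subsetPset => w; rewrite /A /=.
    by apply: le_trans; rewrite ler_nat.
apply: cvg0_measure_eps => // eta eta0.
have eta2 : 0 < eta / 2 by rewrite divr_gt0.
have [k _ /(_ k (leqnn _)) Ak] :=
  near_measure_le (fun=> measure_ge0 _ _) eta2 PA.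
have ek : 0 < eps / k.+1%:R by rewrite divr_gt0 ?ltr0n.
apply: filterS (near_measure_le (fun=> measure_ge0 _ _) eta2 (cZ _ ek)) => n Zn.
have mB := measurable_dist_ge (eps / k.+1%:R) (mZ n) mZl.
rewrite (splitr eta) EFinD; apply: le_trans (leeD Ak Zn).
apply: le_trans (measureU2 _ (mA k) mB); apply: le_measure; rewrite ?inE.
- by apply: measurable_dist_ge; exact: measurable_funM.
- exact: measurableU.
move=> w /=; rewrite -mulrBr normrM => le_eps.
have [?|Clt] := leP k.+1%:R `|C w|; [by left|right].
rewrite leNgt; apply/negP => Zlt.
move: le_eps; rewrite leNgt => /negP; apply.
have k0 : 0 < k.+1%:R :> R by rewrite ltr0n.
rewrite (@le_lt_trans _ _ (k.+1%:R * `|Z n w - Zl w|))//.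
  by rewrite ler_wpM2r// ltW.
by rewrite mulrC -ltr_pdivlMr.
Qed.

Lemma cvg_in_probability_cst Zl :
  cvg_in_probability P \oo (fun=> Zl) Zl.
Proof.
move=> eps eps0; rewrite (_ : [set w | _] = set0).
  by rewrite measure0; exact: cvg_cst.
rewrite -subset0 => w /=; rewrite subrr normr0 => /(lt_le_trans eps0).
by rewrite ltxx.
Qed.

Lemma cvg_in_probability_sum m (Z : nat -> nat -> T -> R) (Zl : nat -> T -> R) :
  (forall k n, measurable_fun setT (Z k n)) ->
  (forall k, measurable_fun setT (Zl k)) ->
  (forall k, cvg_in_probability P \oo (Z k) (Zl k)) ->
  cvg_in_probability P \oo (fun n w => \sum_(k < m) Z k n w)
    (fun w => \sum_(k < m) Zl k w).
Proof.
move=> mZ mZl cZ; elim: m => [|m ih].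
  have sum0 (h : nat -> T -> R) : (fun w => \sum_(k < 0) h k w) = cst 0.
    by apply/funext => w; rewrite big_ord0.
  rewrite sum0 (funext (fun n => sum0 (Z ^~ n))).
  exact: cvg_in_probability_cst.
have sumS (h : nat -> T -> R) : (fun w => \sum_(k < m.+1) h k w) =
    fun w => \sum_(k < m) h k w + h m w.
  by apply/funext => w; rewrite big_ord_recr.
rewrite sumS (funext (fun n => sumS (Z ^~ n))).
by apply: cvg_in_probabilityD => // *; exact: measurable_sum.
Qed.

Lemma cvg_in_probability_unique Z Zl Wl :
  (forall n, measurable_fun setT (Z n)) -> measurable_fun setT Zl ->
  measurable_fun setT Wl ->
  cvg_in_probability P \oo Z Zl -> cvg_in_probability P \oo Z Wl ->
  {ae P, forall w, Zl w = Wl w}.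
Proof.
move=> mZ mZl mWl cZ cW.
have dist0 (eps : R) : 0 < eps -> {ae P, forall w, `|Zl w - Wl w| < eps}.
  move=> eps0; have mA := measurable_dist_ge eps mZl mWl.
  have e2 : 0 < eps / 2 by rewrite divr_gt0.
  exists [set w | eps <= `|Zl w - Wl w|]; split => //; last first.
    by move=> w /= /negP; rewrite -leNgt.
  have := cvgeD _ (cZ _ e2) (cW _ e2); rewrite adde0 => /(_ _ isT) c0.
  suff : (fun=> P [set w | eps <= `|Zl w - Wl w|]) @ \oo --> 0%E.
    by apply: cvg_unique => //; exact: cvg_cst.
  apply: cvg0_measure_le c0 => // n /=.
  have mB := measurable_dist_ge (eps / 2) (mZ n) mZl.
  have mC := measurable_dist_ge (eps / 2) (mZ n) mWl.
  apply: le_trans (measureU2 _ mB mC); apply: le_measure; rewrite ?inE//.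
    exact: measurableU.
  move=> w /= le_eps.
  have [?|Zlt] := leP (eps / 2) `|Z n w - Zl w|; [by left|right].
  rewrite leNgt; apply/negP => Wlt.
  move: le_eps; rewrite leNgt => /negP; apply.
  rewrite -(subrKA (Z n w)) (le_lt_trans (ler_normD _ _))//.
  by rewrite distrC [ltRHS](splitr eps) ltrD.
have : {ae P, forall w, forall n : nat, `|Zl w - Wl w| < n.+1%:R^-1}.
  by apply: ae_foralln => n; apply: dist0; rewrite invr_gt0 ltr0n.
apply: filterS => w lt_dist.
apply/eqP; rewrite -subr_eq0 -normr_eq0; apply/eqP/le_anti.
rewrite normr_ge0 andbT; apply/ler_addgt0Pl => e e0; rewrite addr0.
have [n _ /(_ n (leqnn _)) ne] := near_infty_natSinv_lt (PosNum e0).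
exact: ltW (lt_trans (lt_dist n) ne).
Qed.

End InProbability.

(** * Continuous paths observed through a grid *)

Section Paths.
Context {R : realType}.

(** Truncating time to [[0, L]] turns a path that is continuous on the half-line
    into a uniformly continuous function on the whole line, so that rational
    times are available near every time, end points included. *)
Definition clamp (L x : R) : R := Num.max 0 (Num.min x L).

Lemma clamp_ge0 (L x : R) : 0 <= clamp L x.
Proof. by rewrite le_max lexx. Qed.

Lemma clamp_id (L : R) x : 0 <= x <= L -> clamp L x = x.
Proof. by move=> /andP[x0 xL]; rewrite /clamp (min_idPl xL) (max_idPr x0). Qed.

Lemma clamp_le (L : R) x : 0 <= L -> clamp L x <= L.
Proof. by move=> L0; rewrite ge_max L0 ge_min lexx orbT. Qed.

Lemma dist_clamp (L : R) x y : `|clamp L x - clamp L y| <= `|x - y|.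
Proof.
have dist_max (a b : R) : `|Num.max 0 a - Num.max 0 b| <= `|a - b|.
  by case: (leP 0 a) => ?; case: (leP 0 b) => ?; case: (ger0P (a - b)) => ?;
    rewrite ?ler_norml; lra.
apply: le_trans (dist_max _ _) _.
by case: (leP x L) => ?; case: (leP y L) => ?; case: (ger0P (x - y)) => ?;
  rewrite ?ler_norml; lra.
Qed.

Lemma continuous_clamp (L : R) : continuous (clamp L).
Proof.
move=> x; apply/cvgrPdist_lt => e e0; near=> y.
apply: le_lt_trans (dist_clamp _ _ _) _.
by near: y; apply/nbhs_ballP; exists e.
Unshelve. all: by end_near. Qed.

Lemma continuous_comp_clamp (L : R) (f : R -> R) :
  {within `[0, +oo[, continuous f} -> continuous (f \o clamp L).
Proof.
move=> /subspace_continuousP cf x.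
have fx := cf (clamp L x); apply: (cvg_trans _ (fx _)); last first.
  by rewrite /= in_itv/= clamp_ge0.
move=> U /= fU.
have := @continuous_clamp L x _ fU.
apply: (@filterS _ (nbhs x)) => y; apply.
by rewrite /= in_itv/= clamp_ge0.
Qed.

Lemma uniform_continuous_clamp (L : R) (f : R -> R) : 0 <= L ->
  {within `[0, +oo[, continuous f} -> forall eps : R, 0 < eps ->
  exists2 delta : R, 0 < delta & forall x y : R, `|x - y| < delta ->
    `|f (clamp L x) - f (clamp L y)| < eps.
Proof.
move=> L0 /(@continuous_comp_clamp L) cf eps eps0.
have e2 : 0 < eps / 2 by rewrite divr_gt0.
have /compact_near_coveringP cov := @segment_compact R 0 L.
pose Q (delta : R) x := forall y, `|x - y| < delta ->
  `|f (clamp L x) - f (clamp L y)| < eps.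
have : \forall delta \near (0 : R)^'+, `[0, L] `<=` Q delta.
  apply: cov => x _; have /cvgrPdist_lt/(_ _ e2) := cf x.
  move=> /nbhs_ballP[eta /= eta0 xeta].
  have eta2 : 0 < eta / 2 by rewrite divr_gt0.
  exists (ball x (eta / 2), [set delta | delta < eta / 2]) => /=.
    by split; [exact: nbhsx_ballx|exact: nbhs_right_lt].
  move=> [x' delta]/= [xx' dlt] y x'y.
  have near_x z : `|x - z| < eta -> `|f (clamp L x) - f (clamp L z)| < eps / 2.
    exact: xeta.
  rewrite -(subrKA (f (clamp L x))) (le_lt_trans (ler_normD _ _))//.
  rewrite [ltRHS]splitr ltrD//; [rewrite distrC|]; apply: near_x.
    by rewrite (lt_le_trans xx')// ler_pdivrMr// ler_pMr// ler1n.
  rewrite -(subrKA x') (le_lt_trans (ler_normD _ _))//.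
  by rewrite [ltRHS]splitr ltrD// (lt_trans x'y).
have dpos : \forall delta \near (0 : R)^'+, 0 < delta by exact: nbhs_right_gt.
move=> /(filterI dpos)/filter_ex[delta [delta0 Qd]].
exists delta => // x y xy.
have clampK z : clamp L (clamp L z) = clamp L z.
  by rewrite clamp_id// clamp_ge0 clamp_le.
rewrite -(clampK x) -(clampK y); apply: Qd.
  by rewrite /= in_itv/= clamp_ge0 clamp_le.
exact: le_lt_trans (dist_clamp _ _ _) xy.
Qed.

End Paths.

Section Oscillation.
Context {disp : measure_display} {T : measurableType disp} {R : realType}.
Variable P : probability T R.

(** The event that a path oscillates by [eps] at scale [1 / (n + 1)] is an
    uncountable union, so it is enclosed in the measurable event that the path
    oscillates by [eps / 2] between two rational times.  The latter decrease
    with [n] and only paths that are not uniformly continuous belong to all of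
    them, hence their probabilities vanish. *)
Lemma oscillation_negligible (Z : R -> T -> R) (eps : R) : 0 < eps ->
  (forall x, measurable_fun setT (Z x)) ->
  {ae P, forall w, forall eta : R, 0 < eta -> exists2 delta : R, 0 < delta &
    forall x y, `|x - y| < delta -> `|Z x w - Z y w| < eta} ->
  exists B : nat -> set T, [/\ forall n, measurable (B n),
    P (B n) @[n --> \oo] --> 0%E &
    {ae P, forall w, forall n x y, `|x - y| < n.+1%:R^-1 ->
      eps <= `|Z x w - Z y w| -> B n w}].
Proof.
move=> eps0 mZ ucZ; have e2 : 0 < eps / 2 by rewrite divr_gt0.
pose D n (q : rat * rat) : set T :=
  [set w | `|ratr q.1 - ratr q.2 : R| < n.+1%:R^-1 /\
           eps / 2 <= `|Z (ratr q.1) w - Z (ratr q.2) w|].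
have mD n q : measurable (D n q).
  rewrite /D; have [lt_n|_] := boolP (`|ratr q.1 - ratr q.2 : R| < n.+1%:R^-1).
    rewrite (_ : mkset _ =
        [set w | eps / 2 <= `|Z (ratr q.1) w - Z (ratr q.2) w|]).
      exact: measurable_dist_ge.
    by apply/seteqP; split=> w //= [].
  by rewrite (_ : mkset _ = set0)//; apply/seteqP; split=> w //= [].
pose B n := \bigcup_q D n q.
have mB n : measurable (B n).
  by apply: countable_bigcupT_measurable => //; exact: countableP.
exists B; split=> //.
- rewrite (_ : 0%E = P (\bigcap_n B n)).
    apply: nonincreasing_cvg_mu => //.
    + by rewrite (le_lt_trans (probability_le1 _ _)) ?ltry.
    + exact: bigcapT_measurable.
    + move=> m n mn; apply/subsetPset => w [q _ [lt_n ge_e]]; exists q => //.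
      split => //; apply: lt_le_trans lt_n _.
      by rewrite lef_pV2 ?posrE ?ltr0n// ler_nat.
  apply/esym/measure_negligible; first exact: bigcapT_measurable.
  apply: negligibleS ucZ => w Bw /= /(_ _ e2)[delta delta0 cd].
  have [n _ /(_ n (leqnn _)) /= nd] := near_infty_natSinv_lt (PosNum delta0).
  have [q _ [qn]] := Bw n I; rewrite leNgt => /negP; apply.
  by apply: cd; exact: lt_trans qn nd.
- apply: filterS ucZ => w ucw n x y xy eps_le.
  have e4 : 0 < eps / 4 by rewrite divr_gt0.
  have [delta delta0 cd] := ucw _ e4.
  (* rational times this close to [x] and [y] are still within the scale of
     each other, and each value moves by less than [eps / 4] *)
  have [eta [eta0 eta_delta eta_n]] : exists eta : R,
      [/\ 0 < eta, eta <= delta & eta + eta <= n.+1%:R^-1 - `|x - y|].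
    exists (Num.min delta ((n.+1%:R^-1 - `|x - y|) / 2)); split.
    - by rewrite lt_min delta0 divr_gt0// subr_gt0.
    - by rewrite ge_min lexx.
    - by rewrite [leRHS]splitr lerD// ge_min lexx orbT.
  have near_rat z : exists q : rat, `|z - ratr q| < eta.
    have [|q /andP[zq qz]] := @rat_in_itvoo R z (z + eta).
      by rewrite ltrDl.
    by exists q; rewrite distrC ger0_norm ?subr_ge0 ?ltW// ltrBlDl.
  have [p px] := near_rat x; have [q qy] := near_rat y.
  have tri (a b c d : R) : `|a - d| <= `|b - a| + (`|b - c| + `|d - c|).
    rewrite -(subrKA b) (le_trans (ler_normD _ _))// [`|b - a|]distrC lerD2l.
    by rewrite -(subrKA c) [`|d - c|]distrC ler_normD.
  exists (p, q) => //; split => /=.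
    apply: le_lt_trans (tri _ x y _) _; rewrite [`|ratr q - y|]distrC.
    by move: n.+1%:R^-1 eta_n => r; lra.
  rewrite leNgt; apply/negP => lt_e2.
  move: eps_le; rewrite leNgt => /negP; apply.
  have xp := cd _ _ (lt_le_trans px eta_delta).
  have yq := cd _ _ (lt_le_trans qy eta_delta).
  apply: le_lt_trans (tri _ (Z (ratr p) w) (Z (ratr q) w) _) _.
  by rewrite [`|Z (ratr p) w - Z x w|]distrC; lra.
Qed.

End Oscillation.

(** * Stratonovich integrals as limits of trapezoidal sums *)

Section Trapezoid.
Context {disp : measure_display} {T : measurableType disp} {R : realType}.
Variables (P : probability T R) (F : R -> set_system T).
Hypothesis F_filtration : filtration F.
Implicit Types (X Y : R -> T -> R) (s t r : R) (I : T -> R).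

Definition trapezoid Y X s (p : seq R) (w : T) : R :=
  \sum_(e <- steps s p) (Y e.1 w + Y e.2 w) / 2 * (X e.2 w - X e.1 w).

Lemma measurable_wrt_fun r I : measurable_wrt (F r) I -> measurable_fun setT I.
Proof.
case: F_filtration => _ Fm _ mI _ B mB; apply/Fm/mI.
by exists B.
Qed.

Lemma semimartingale_adapted s Y : continuous_semimartingale_from P F s Y ->
  forall r, s <= r -> measurable_wrt (F r) (Y r).
Proof.
move=> [aY _] r sr; have := aY (r - s); rewrite subr_ge0 => /(_ sr).
by rewrite addrC subrK.
Qed.

Lemma semimartingale_measurable s Y : continuous_semimartingale_from P F s Y ->
  forall r, s <= r -> measurable_fun setT (Y r).
Proof.
by move=> sY r sr; exact: measurable_wrt_fun (semimartingale_adapted sY sr).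
Qed.

Lemma increment_measurable s X :
  continuous_semimartingale_from P F s (fun r w => X r w - X s w) ->
  forall r r', s <= r -> s <= r' ->
    measurable_fun setT (fun w => X r' w - X r w).
Proof.
move=> sX r r' sr sr'.
(* [X] is observed only through its increments from [s] *)
rewrite (_ : (fun w => _) = fun w => (X r' w - X s w) - (X r w - X s w)).
  by apply: measurable_funB; exact: (semimartingale_measurable sX).
by apply/funext => w; rewrite opprB addrA subrK.
Qed.

Lemma semimartingale_uniform_continuous s L Y : 0 <= L ->
  continuous_semimartingale_from P F s Y ->
  {ae P, forall w, forall eps : R, 0 < eps -> exists2 delta : R, 0 < delta &
    forall x y, `|x - y| < delta ->
      `|Y (s + clamp L x) w - Y (s + clamp L y) w| < eps}.
Proof.
move=> L0 [_ [M [A [_ cM _ cA YMA]]]].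
apply: filterS3 cM cA YMA => w cM cA YMA eps eps0.
have e2 : 0 < eps / 2 by rewrite divr_gt0.
have [d1 d10 Md1] := uniform_continuous_clamp L0 cM e2.
have [d2 d20 Ad2] := uniform_continuous_clamp L0 cA e2.
exists (Num.min d1 d2) => [|x y]; first by rewrite lt_min d10.
rewrite lt_min => /andP[/Md1 Mxy /Ad2 Axy].
rewrite !YMA ?clamp_ge0// opprD addrACA (le_lt_trans (ler_normD _ _))//.
by rewrite [ltRHS]splitr ltrD.
Qed.

Lemma trapezoid_measurable s t Y X p :
  (forall r, s <= r -> measurable_fun setT (Y r)) ->
  (forall r r', s <= r -> s <= r' ->
    measurable_fun setT (fun w => X r' w - X r w)) ->
  itv_partition s t p -> measurable_fun setT (trapezoid Y X s p).
Proof.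
move=> mY mX stp; rewrite /trapezoid.
(* pairs that are not steps have to be discarded beforehand, since [Y] and [X]
   are measurable only after [s] *)
have -> : (fun w => \sum_(e <- steps s p)
      (Y e.1 w + Y e.2 w) / 2 * (X e.2 w - X e.1 w)) = fun w =>
    \sum_(e <- steps s p) (if e \in steps s p then
      (Y e.1 w + Y e.2 w) / 2 * (X e.2 w - X e.1 w) else 0).
  by apply/funext => w; apply: eq_big_seq => e ->.
apply: measurable_sum => e.
have [ep|_] := boolP (e \in steps s p); last exact: measurable_cst.
have [? _ ? _] := steps_bounds stp ep.
apply: measurable_funM; last exact: mX.
by apply: measurable_funM => //; apply: measurable_funD; exact: mY.
Qed.

(** Sampling the integrand at the left end of each step gives simple processes;
    since the paths are uniformly continuous on [[s, t]], their distance to the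
    integrand is at most an oscillation at the scale of the mesh. *)
Lemma sampled_ucp s t Y (p : nat -> seq R)
    (H : nat -> simple_process F s t) :
  continuous_semimartingale_from P F s Y ->
  (forall n, sp_grid (H n) = p n) ->
  (forall n k, sp_coef (H n) k = Y (grid_point s t (p n) k)) ->
  mesh s t (p n) @[n --> \oo] --> 0 ->
  ucp_cvg P H Y.
Proof.
move=> sY Hp HY mesh0 eps eps0.
have stp n : itv_partition s t (p n) by rewrite -Hp; exact: sp_gridP.
have st := itv_partition_le (stp 0%N).
have L0 : 0 <= t - s by rewrite subr_ge0.
have [|B [mB PB0 YB]] := oscillation_negligible eps0 _
  (semimartingale_uniform_continuous L0 sY).
  by move=> x; apply: (semimartingale_measurable sY); rewrite lerDl clamp_ge0.
case: YB => N [mN PN0 YN].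
apply: cvg0_measure_eps => [n|eta eta0]; first exact: mu_ext_ge0.
have [m _ /(_ m (leqnn _)) PBm] :=
  near_measure_le (fun=> measure_ge0 _ _) eta0 PB0.
have m0 : 0 < m.+1%:R^-1 :> R by rewrite invr_gt0 ltr0n.
move/cvgr0Pnorm_lt : mesh0 => /(_ _ m0); apply: filterS => n.
rewrite ger0_norm ?mesh_ge0// => meshn.
rewrite (@le_trans _ _ (P (B m `|` N)))//; last by rewrite measureU0.
rewrite -measurable_mu_extE; last exact: measurableU.
apply: le_mu_ext => w [r [sr rt]].
have srt : s < r <= t by rewrite sr.
rewrite /sp_val Hp; under eq_bigr do rewrite HY.
rewrite (big_grid 0 +%R (fun x y => Y x w * (x < r <= y)%R%:R)).
have [e ep [/andP[er re] ->]] := step_value (Y ^~ w) (stp n) srt.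
have [se et _ _] := steps_bounds (stp n) ep.
move=> le_eps; have [?|nNw] := pselect (N w); [by right|left].
have Yw := contra_notP (YN w) nNw.
have cl x : s <= x <= t -> s + clamp (t - s) (x - s) = x.
  by move=> /andP[sx xt]; rewrite clamp_id ?subr_ge0 ?sx ?lerD2r// addrC subrK.
apply: (Yw m (e.1 - s) (r - s)).
  rewrite opprB addrA subrK distrC ger0_norm; last by rewrite subr_ge0 ltW.
  apply: le_lt_trans meshn; apply: le_trans (step_le_mesh t ep).
  by rewrite lerD2r.
by rewrite !cl ?se ?et ?(ltW sr) ?rt.
Qed.

(** The Ito integral is the limit of left-point sums and the covariation that
    of products of increments; adding half of the latter to the former turns
    the left-point sums into trapezoidal ones. *)
Lemma stratonovich_trapezoid s t Y X I (p : nat -> seq R) :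
  stratonovich_integral P F Y X s t I ->
  (forall n, itv_partition s t (p n)) ->
  mesh s t (p n) @[n --> \oo] --> 0 ->
  cvg_in_probability P \oo (fun n => trapezoid Y X s (p n)) I.
Proof.
move=> [sY sX mI [J [Q [[mJ cJ] [mQ cQ] IJQ]]]] stp mesh0.
have mY := semimartingale_measurable sY.
have mX := increment_measurable sX.
have coefP n k : (k < size (p n))%N ->
    measurable_wrt (F (grid_point s t (p n) k)) (Y (grid_point s t (p n) k)).
  move=> kp; apply: (semimartingale_adapted sY).
  by apply: itv_partition_nth_ge (stp n); exact: ltnW.
pose H n := SimpleProcess (stp n) (coefP n).
have HY : ucp_cvg P H Y.
  exact: (sampled_ucp (p := p) (H := H) sY (fun=> erefl) (fun _ _ => erefl)).
have cvgJ := cJ H HY.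
have cvgQ := cQ p stp mesh0.
have mtrap n := trapezoid_measurable mY mX (stp n).
have mgrid n k : (k < (size (p n)).+1)%N -> s <= grid_point s t (p n) k.
  by move=> kp; exact: itv_partition_nth_ge (stp n).
have mXk n (k : 'I_(size (p n))) : measurable_fun setT
    (fun w => X (grid_point s t (p n) k.+1) w - X (grid_point s t (p n) k) w).
  by apply: mX; apply: mgrid; rewrite ltnS// ltnW.
have mS n : measurable_fun setT (sp_integral (H n) X).
  apply: measurable_sum => k; apply: measurable_funM; last exact: mXk.
  by apply: mY; apply: mgrid; rewrite ltnS ltnW.
have mC n : measurable_fun setT (fun w =>
   \sum_(k < size (p n))
     (Y (grid_point s t (p n) k.+1) w - Y (grid_point s t (p n) k) w) *
     (X (grid_point s t (p n) k.+1) w - X (grid_point s t (p n) k) w)).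
  apply: measurable_sum => k; apply: measurable_funM; last exact: mXk.
  by apply: measurable_funB; apply: mY; apply: mgrid; rewrite ltnS// ltnW.
have half : measurable_fun setT (cst (2^-1) : T -> R) by exact: measurable_cst.
have cvghQ := cvg_in_probabilityMl half mC mQ cvgQ.
have := cvg_in_probabilityD mS mJ (fun n => measurable_funM half (mC n))
  (measurable_funM half mQ) cvgJ cvghQ.
apply: cvg_in_probability_ae => //.
- by move=> n; apply: measurable_funD => //; exact: measurable_funM.
- by apply: measurable_funD => //; exact: measurable_funM.
- move=> n; apply: aeW => w.
  rewrite /sp_integral /trapezoid /=.
  rewrite (big_grid 0 +%R (fun x y => Y x w * (X y w - X x w))).
  rewrite (big_grid 0 +%R (fun x y => (Y y w - Y x w) * (X y w - X x w))).
  rewrite mulr_sumr -big_split/=; apply: eq_bigr => e _; lra.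
- by apply: filterS IJQ => w ->.
Qed.

End Trapezoid.

(** * Splitting integrals, and Chen's identity *)

Section Splitting.
Context {disp : measure_display} {T : measurableType disp} {R : realType}.
Variables (P : probability T R) (F : R -> set_system T).
Hypothesis F_filtration : filtration F.
Implicit Types (X Y : R -> T -> R) (s t r : R) (I : T -> R).

Lemma trapezoid_cat Y X s (p q : seq R) w :
  trapezoid Y X s (p ++ q) w =
  trapezoid Y X s p w + trapezoid Y X (last s p) q w.
Proof. by rewrite /trapezoid steps_cat big_cat. Qed.

(** Both sides are limits in probability of the same trapezoidal sums, taken
    over partitions of [[s, t]] that contain [u].  The factors [C k] come out of
    the sums over [[u, t]] by distributivity. *)
Lemma stratonovich_split s u t X Y Y1 I I1 (c : R) (m : nat)
    (C : nat -> T -> R) (Z : nat -> R -> T -> R) (K : nat -> T -> R) :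
  s <= u -> u <= t ->
  stratonovich_integral P F Y X s t I ->
  stratonovich_integral P F Y1 X s u I1 ->
  (forall r w, Y r w = c * Y1 r w) ->
  (forall k, stratonovich_integral P F (Z k) X u t (K k)) ->
  (forall k, measurable_fun setT (C k)) ->
  (forall r, u <= r ->
    {ae P, forall w, Y r w = \sum_(k < m) C k w * Z k r w}) ->
  {ae P, forall w, I w = c * I1 w + \sum_(k < m) C k w * K k w}.
Proof.
move=> su ut sI sI1 Yc sK mC YZ.
have [p [sup mesh_p]] := exists_partitions su.
have [q [utq mesh_q]] := exists_partitions ut.
have stpq n : itv_partition s t (p n ++ q n).
  exact: itv_partition_cat (sup n) (utq n).
have mesh_pq : mesh s t (p n ++ q n) @[n --> \oo] --> 0.
  apply: (@squeeze_cvgr _ _ _ _ (cst 0)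
    (fun n => mesh s u (p n) + mesh u t (q n))).
  - by apply: nearW => n; rewrite mesh_ge0 mesh_cat.
  - exact: cvg_cst.
  - by rewrite -[X in _ --> X]addr0; exact: cvgD.
have cI := stratonovich_trapezoid F_filtration sI stpq mesh_pq.
have cI1 := stratonovich_trapezoid F_filtration sI1 sup mesh_p.
have cK k := stratonovich_trapezoid F_filtration (sK k) utq mesh_q.
have mtrap s' t' Y' I' (p' : nat -> seq R) n :
    stratonovich_integral P F Y' X s' t' I' ->
    itv_partition s' t' (p' n) ->
    measurable_fun setT (trapezoid Y' X s' (p' n)).
  case=> sY sX _ _; apply: trapezoid_measurable.
    exact: (semimartingale_measurable F_filtration sY).
  exact: (increment_measurable F_filtration sX).
have mI : measurable_fun setT I by case: sI.
have mI1 : measurable_fun setT I1 by case: sI1.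
have mK k : measurable_fun setT (K k) by case: (sK k).
have mc : measurable_fun setT (cst c : T -> R) by exact: measurable_cst.
have mpq n := mtrap _ _ _ _ (fun n => p n ++ q n) n sI (stpq n).
have mp n := mtrap _ _ _ _ p n sI1 (sup n).
have mq k n := mtrap _ _ _ _ q n (sK k) (utq n).
have mCq k n := measurable_funM (mC k) (mq k n).
have mCK k := measurable_funM (mC k) (mK k).
have cS := cvg_in_probability_sum m mCq mCK
  (fun k => cvg_in_probabilityMl (mC k) (mq k) (mK k) (cK k)).
have mS n : measurable_fun setT
    (fun w => \sum_(k < m) C k w * trapezoid (Z k) X u (q n) w).
  by apply: measurable_sum => k; exact: mCq.
have mSl : measurable_fun setT (fun w => \sum_(k < m) C k w * K k w).
  by apply: measurable_sum => k; exact: mCK.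
have mcp n := measurable_funM mc (mp n).
have mcI1 := measurable_funM mc mI1.
have ccI1 := cvg_in_probabilityMl mc mp mI1 cI1.
have cR := @cvg_in_probabilityD _ _ _ P
  (fun n w => c * trapezoid Y1 X s (p n) w) (fun w => c * I1 w)
  (fun n w => \sum_(k < m) C k w * trapezoid (Z k) X u (q n) w)
  (fun w => \sum_(k < m) C k w * K k w) mcp mcI1 mS mSl ccI1 cS.
have mR n := measurable_funD (mcp n) (mS n).
have mRl := measurable_funD mcI1 mSl.
apply: (cvg_in_probability_unique mpq mI mRl cI).
apply: (cvg_in_probability_ae mR mRl mpq mRl _ _ cR); last exact: aeW.
move=> n.
have : {ae P, forall w, forall k : 'I_(size (u :: q n)),
    Y (nth u (u :: q n) k) w =
    \sum_(j < m) C j w * Z j (nth u (u :: q n) k) w}.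
  apply: ae_forall_countable => k; apply: YZ.
  rewrite (set_nth_default t)//; exact: itv_partition_nth_ge (utq n).
apply: filterS => w Yw.
have Yu r : r \in u :: q n -> Y r w = \sum_(j < m) C j w * Z j r w.
  by move=> /(nthP u)[k klt <-]; exact: (Yw (Ordinal klt)).
rewrite trapezoid_cat (itv_partition_last (sup n)) /= /trapezoid; congr (_ + _).
  by rewrite mulr_sumr; apply: eq_bigr => e _; rewrite !Yc; lra.
under eq_bigr do rewrite mulr_sumr.
rewrite exchange_big; apply: eq_big_seq => e eq /=.
have [e1 e2] : e.1 \in u :: q n /\ e.2 \in u :: q n.
  by by split; [exact: mem_steps1 eq|rewrite in_cons (mem_steps2 eq) orbT].
rewrite !Yu// -big_split/= mulr_suml mulr_suml; apply: eq_bigr => j _; lra.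
Qed.

End Splitting.

Section Chen.
Context {disp : measure_display} {T : measurableType disp} {R : realType}.
Variables (P : probability T R) (F : R -> set_system T) (d : nat).
Variables (lambda : 'rV[R]_d) (X : R -> T -> 'rV[R]_d).
Variable XX : \bar R -> R -> T -> tensor_series R d.
Hypothesis F_filtration : filtration F.
Hypothesis XX_signature : is_efm_signature P F lambda X XX.
Implicit Types (s : \bar R) (u t r : R) (v : seq 'I_d) (i : 'I_d).

Local Notation weight := (word_weight lambda).
Local Notation decay v h := (expR (- (weight v * h))).
Local Notation integrand s t v i :=
  (fun r w => decay (rcons v i) (t - r) * XX s r w v).
Local Notation coordinate i := (fun r w => X r w 0 i).

Lemma weight_rcons v i : weight (rcons v i) = weight v + lambda 0 i.
Proof. by rewrite /word_weight -cats1 big_cat big_seq1. Qed.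

Lemma weight_take_drop k v : weight v = weight (take k v) + weight (drop k v).
Proof. by rewrite /word_weight -{1}(cat_take_drop k v) big_cat. Qed.

(** The letter [i] makes the component of [v] appear in the integrand of an
    integral, and integrands are adapted; for the empty word this is the only
    source of measurability, since its component is known almost surely only. *)
Lemma signature_measurable s u v i : (s <= u%:E)%E ->
  measurable_fun setT (fun w => XX s u w v).
Proof.
have [_ XXfin XXinf] := XX_signature.
have mXX a : a <= u ->
    continuous_semimartingale_from P F a (integrand s u v i) ->
    measurable_fun setT (fun w => XX s u w v).
  move=> au /(semimartingale_measurable F_filtration)/(_ _ au).
  by under eq_fun do rewrite subrr mulr0 oppr0 expR0 mul1r.
case: s mXX => [s mXX su|//|mXX _].
  by have [sY _ _ _] := XXfin _ _ v i su; exact: mXX sY.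
have [_ [J [/(_ _ (lexx u))[sY _ _ _] _]]] := XXinf u v i.
exact: mXX sY.
Qed.

Lemma tensor_mul_discount_rcons s u t v i w : XX u%:E t w [::] = 1 ->
  tensor_mul (discount lambda (t - u) (XX s u w)) (XX u%:E t w) (rcons v i) =
  decay (rcons v i) (t - u) * XX s u w (rcons v i) +
  \sum_(k < (size v).+1) decay (take k v) (t - u) * XX s u w (take k v)
                         * XX u%:E t w (rcons (drop k v) i).
Proof.
move=> XX1; rewrite /tensor_mul /discount size_rcons big_ord_recr/= addrC.
rewrite take_oversize ?drop_oversize ?size_rcons// XX1 mulr1; congr (_ + _).
apply: eq_bigr => k _; have kv : (k <= size v)%N by rewrite -ltnS.
have -> : take k (rcons v i) = take k v by rewrite -cats1 takel_cat.
by rewrite drop_rcons.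
Qed.

(** The discount factor is multiplicative along the word, so the discount of a
    prefix over [[u, r]] and that of the integrand over [[r, t]] recombine into
    a discount of the prefix over [[u, t]], constant in [r], and the integrand
    of the component of the remaining suffix. *)
Lemma decay_split u r t k v i :
  decay (rcons v i) (t - r) * decay (take k v) (r - u) =
  decay (take k v) (t - u) * decay (rcons (drop k v) i) (t - r).
Proof.
rewrite -!expRD !weight_rcons (weight_take_drop k v); congr expR; ring.
Qed.

(** Induction on the last letter: splitting the outermost integral at [u] gives
    the term where the prefix is the whole word, and the induction hypothesis
    under the integral over [[u, t]] gives all the others. *)
Lemma signature_chen_word v s u t : (s <= u%:E)%E -> u <= t ->
  {ae P, forall w, XX s t w v =
    tensor_mul (discount lambda (t - u) (XX s u w)) (XX u%:E t w) v}.
Proof.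
have [XX1 XXfin XXinf] := XX_signature.
elim/last_ind: v s u t => [|v i ih] s u t su ut.
  have uu : (u%:E <= t%:E)%E by rewrite lee_fin.
  apply: filterS3 (XX1 s u su) (XX1 u%:E t uu) (XX1 s t (le_trans su uu)).
  move=> w XXsu XXut XXst; rewrite /tensor_mul big_ord_recl big_ord0 addr0/=.
  rewrite /discount XXsu XXut XXst /word_weight big_nil.
  by rewrite mul0r oppr0 expR0 !mulr1.
pose C k w := decay (take k v) (t - u) * XX s u w (take k v).
pose Z k : R -> T -> R := integrand u%:E t (drop k v) i.
pose K k w := XX u%:E t w (rcons (drop k v) i).
pose c := decay (rcons v i) (t - u).
have sK k : stratonovich_integral P F (Z k) (coordinate i) u t (K k).
  exact: XXfin.
have mC k : measurable_fun setT (C k).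
  by apply: measurable_funM => //; exact: signature_measurable i su.
have Yc r w : integrand s t v i r w = c * integrand s u v i r w.
  by rewrite mulrA -expRD; congr (expR _ * _); ring.
have YZ r : u <= r -> {ae P, forall w,
    integrand s t v i r w = \sum_(k < (size v).+1) C k w * Z k r w}.
  move=> ur; apply: filterS (ih s u r su ur) => w ->.
  rewrite /tensor_mul /discount mulr_sumr; apply: eq_bigr => k _.
  by rewrite !mulrA decay_split /C /Z; ring.
have split (a : R) I I1 : a <= u ->
    stratonovich_integral P F (integrand s t v i) (coordinate i) a t I ->
    stratonovich_integral P F (integrand s u v i) (coordinate i) a u I1 ->
    {ae P, forall w, I w = c * I1 w + \sum_(k < (size v).+1) C k w * K k w}.
  by move=> au sI sI1; exact: stratonovich_split au ut sI sI1 Yc sK mC YZ.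
suff : {ae P, forall w, XX s t w (rcons v i) =
    c * XX s u w (rcons v i) + \sum_(k < (size v).+1) C k w * K k w}.
  have uu : (u%:E <= t%:E)%E by rewrite lee_fin.
  by apply: filterS2 (XX1 u%:E t uu) => w /tensor_mul_discount_rcons ->.
case: s su C c mC Yc YZ split => [s su|//|_] C c mC Yc YZ split.
  apply: (split s) => //; first by apply: XXfin; exact: le_trans ut.
  exact: XXfin.
(* the improper integrals are limits along the lower endpoints [u - n] *)
have [mI [J [sJ cJ]]] := XXinf t v i.
have [mI1 [J1 [sJ1 cJ1]]] := XXinf u v i.
have past : (u - n%:R) @[n --> \oo] --> -oo.
  apply/cvgrNyPlt => A; apply: filterS (nbhs_infty_gtr (u - A)) => n.
  by rewrite ltrBlDr addrC -ltrBlDr.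
have pastu n : u - n%:R <= u by rewrite lerBlDr lerDl.
pose S w := \sum_(k < (size v).+1) C k w * K k w.
have mS : measurable_fun setT S.
  apply: measurable_sum => k; apply: measurable_funM => //.
  by have [] := sK k.
have mJ n : measurable_fun setT (J (u - n%:R)).
  by have [] := sJ _ (le_trans (pastu n) ut).
have mJ1 n : measurable_fun setT (J1 (u - n%:R)) by have [] := sJ1 _ (pastu n).
have cJn : cvg_in_probability P \oo (fun n => J (u - n%:R))
    (XX -oo%E t ^~ (rcons v i)).
  by move=> eps eps0; exact: cvg_comp past (cJ eps eps0).
have cJ1n : cvg_in_probability P \oo (fun n => J1 (u - n%:R))
    (XX -oo%E u ^~ (rcons v i)).
  by move=> eps eps0; exact: cvg_comp past (cJ1 eps eps0).
have mc : measurable_fun setT (cst c : T -> R) by exact: measurable_cst.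
have mcJ1 n := measurable_funM mc (mJ1 n).
have mcI1 := measurable_funM mc mI1.
have ccJ1 := cvg_in_probabilityMl mc mJ1 mI1 cJ1n.
have cR := @cvg_in_probabilityD _ _ _ P
  (fun n w => c * J1 (u - n%:R) w) (fun w => c * XX -oo%E u w (rcons v i))
  (fun=> S) S mcJ1 mcI1 (fun=> mS) mS ccJ1 (@cvg_in_probability_cst _ _ _ P S).
have mR n := measurable_funD (mcJ1 n) mS.
have mRl := measurable_funD mcI1 mS.
apply: (cvg_in_probability_unique mJ mI mRl cJn).
apply: (cvg_in_probability_ae mR mRl mJ mRl _ _ cR); last exact: aeW.
move=> n.
have := split _ _ _ (pastu n) (sJ _ (le_trans (pastu n) ut)) (sJ1 _ (pastu n)).
by apply: filterS => w ->.
Qed.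

End Chen.

Theorem proposition4p1 (disp : measure_display) (T : measurableType disp)
  (R : realType) (P : probability T R) (F : R -> set_system T) (d : nat)
  (lambda : 'rV[R]_d) (X : R -> T -> 'rV[R]_d)
  (XX : \bar R -> R -> T -> tensor_series R d)
  (F_filtration : filtration F)
  (lambda_gt0 : forall i, 0 < lambda 0 i)
  (X_semimartingale : forall i,
     continuous_increment_semimartingale P F (fun t w => X t w 0 i))
  (XX_signature : is_efm_signature P F lambda X XX)
  (s : \bar R) (u t : R) (le_su : (s <= u%:E)%E) (le_ut : u <= t) :
  {ae P, forall w,
    XX s t w = tensor_mul (discount lambda (t - u) (XX s u w)) (XX u%:E t w)}.

Proof.
have := ae_forall_countable (fun v : seq 'I_d =>
  signature_chen_word F_filtration XX_signature v le_su le_ut).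
by apply: filterS => w chen; apply/funext.
Qed.
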